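(* Let $p$ be a prime, let $n\in\mathbb{N}$, $n\ge1$, and let $SL(n,\mathbb{Q}_p)$ act on the $p$-adic unit sphere $\mathcal{S}_n$ by $T\mapsto\overline{T}$, where $\overline{T}(x)=\|T(x)\|_p\,T(x)$ for $x\in\mathcal{S}_n$. A semigroup $\mathfrak{S}$ of $SL(n,\mathbb{Q}_p)$ acts distally on $\mathcal{S}_n$ if and only if the closure of $\mathfrak{S}$ is a compact group.
   Context: Here $|\cdot|_p$ is the $p$-adic absolute value on $\mathbb{Q}_p$, and for $x=(x_1,\dots,x_n)\in\mathbb{Q}_p^n$, $\|x\|_p=\max_{1\le i\le n}|x_i|_p$. The $p$-adic unit sphere is $\mathcal{S}_n=\{x\in\mathbb{Q}_p^n\mid\|x\|_p=1\}$. For nonzero $v\in\mathbb{Q}_p^n$, $\|v\|_p$ is an integer power $p^m$ of $p$, and in the expression $\|v\|_p\,v$ this power is regarded as the scalar $p^m\in\mathbb{Q}_p$; thus $\|v\|_p\,v$ has norm $1$. Each $\overline{T}$ is a homeomorphism of $\mathcal{S}_n$ and $T\mapsto\overline{T}$ is a group homomorphism. A semigroup in a group is a nonempty subset closed under multiplication. A semigroup $\mathcal{H}$ of homeomorphisms of a Hausdorff topological space $X$ acts distally on $X$ if for every pair of distinct $x,y\in X$, the closure of $\{(h(x),h(y))\mid h\in\mathcal{H}\}$ in $X\times X$ does not intersect the diagonal $\{(d,d)\mid d\in X\}$. A semigroup $\mathfrak{S}$ of matrices acts distally on $\mathcal{S}_n$ if $\{\overline{T}\mid T\in\mathfrak{S}\}$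 does. The closure is taken in the usual $p$-adic topology of $SL(n,\mathbb{Q}_p)$ (a closed subgroup of $GL(n,\mathbb{Q}_p)$). *)

(* Defs.v *)
From HB Require Import structures.
From mathcomp Require Import all_boot all_order all_algebra.
From mathcomp Require Import ring lra.
From mathcomp Require Import all_classical.
From mathcomp Require Import topology.
From mathcomp Require Import normedtype.

Set Implicit Arguments.
Unset Strict Implicit.
Unset Printing Implicit Defensive.

Import Order.TTheory GRing.Theory Num.Theory.

Import numFieldNormedType.Exports.

Local Open Scope classical_set_scope.
Local Open Scope ring_scope.

Section PadicAbs.
Variable p : nat.

Definition padic_val (x : rat) : int :=
  (logn p `|numq x|)%:Z - (logn p `|denq x|)%:Z.

(* All the absolute values below are powers of p or 0, hence are taken in [rat]. *)
Definition padic_abs (x : rat) : rat :=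
  if x == 0 then 0 else p%:R ^ (- padic_val x).

Lemma padic_val_frac (a b : int) : a != 0 -> b != 0 ->
  padic_val (a%:~R / b%:~R) = (logn p `|a|)%:Z - (logn p `|b|)%:Z.
Proof.
move=> a0 b0; set x : rat := a%:~R / b%:~R.
have x0 : x != 0 by rewrite mulf_neq0 ?invr_eq0 ?intr_eq0.
have E : numq x * b = a * denq x.
  apply: (@intr_inj rat); rewrite !rmorphM /= numqE /x.
  by rewrite mulrAC divfK // intr_eq0.
have /(congr1 (logn p)) := congr1 absz E.
rewrite !abszM !lognM ?absz_gt0 ?numq_eq0 ?denq_neq0 // => /(congr1 Posz).
rewrite !PoszD /padic_val => h; apply/eqP; rewrite subr_eq addrAC.
by rewrite eq_sym subr_eq h.
Qed.

Lemma padic_valM x y : x != 0 -> y != 0 ->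
  padic_val (x * y) = padic_val x + padic_val y.
Proof.
move=> x0 y0; rewrite -[x in LHS]divq_num_den -[y in LHS]divq_num_den mulf_div.
rewrite -!intrM padic_val_frac ?mulf_neq0 ?numq_eq0 ?denq_neq0 //.
rewrite !abszM !lognM ?absz_gt0 ?numq_eq0 ?denq_neq0 // !PoszD /padic_val.
by rewrite opprD addrACA.
Qed.

Hypothesis p_pr : prime p.

Lemma p_gt0 : 0 < p%:R :> rat.
Proof. by rewrite ltr0n prime_gt0. Qed.

Lemma padic_abs0 : padic_abs 0 = 0.
Proof. by rewrite /padic_abs eqxx. Qed.

Lemma padic_abs_gt0 x : (0 < padic_abs x) = (x != 0).
Proof.
rewrite /padic_abs; case: (eqVneq x 0) => [_|_] /=; first by rewrite ltxx.
by rewrite exprz_gt0 // p_gt0.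
Qed.

Lemma padic_abs_ge0 x : 0 <= padic_abs x.
Proof.
by case: (eqVneq x 0) => [->|x0]; rewrite ?padic_abs0 // ltW // padic_abs_gt0.
Qed.

Lemma padic_abs_eq0 x : (padic_abs x == 0) = (x == 0).
Proof. by have := padic_abs_gt0 x; rewrite lt0r padic_abs_ge0 andbT => /negb_inj. Qed.

Lemma padic_absM x y : padic_abs (x * y) = padic_abs x * padic_abs y.
Proof.
rewrite /padic_abs mulf_eq0.
case: (eqVneq x 0) => [_|x0]; first by rewrite mul0r.
case: (eqVneq y 0) => [_|y0]; first by rewrite mulr0.
by rewrite /= padic_valM // opprD expfzDr // gt_eqF // p_gt0.
Qed.

Lemma padic_abs1 : padic_abs 1 = 1.
Proof. by rewrite /padic_abs oner_eq0 /padic_val logn1 oppr0 expr0z. Qed.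

Lemma padic_absN x : padic_abs (- x) = padic_abs x.
Proof. by rewrite /padic_abs oppr_eq0 /padic_val numqN denqN abszN. Qed.

Lemma padic_absV x : padic_abs x^-1 = (padic_abs x)^-1.
Proof.
case: (eqVneq x 0) => [->|x0]; first by rewrite !(invr0, padic_abs0).
apply: (@mulfI _ (padic_abs x)); first by rewrite padic_abs_eq0.
by rewrite -padic_absM !mulfV ?padic_abs_eq0 // padic_abs1.
Qed.

Lemma padic_abs_ultra x y :
  padic_abs (x + y) <= Num.max (padic_abs x) (padic_abs y).
Proof.
case: (eqVneq x 0) => [->|x0].
  by rewrite add0r padic_abs0 le_max lexx orbT.
case: (eqVneq y 0) => [->|y0]; first by rewrite addr0 le_max lexx.
case: (eqVneq (x + y) 0) => [->|s0].
  by rewrite padic_abs0 le_max padic_abs_ge0.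
wlog h : x y x0 y0 s0 / padic_val x <= padic_val y.
  move=> H; case: (leP (padic_val x) (padic_val y)) => h; first exact: H.
  by rewrite addrC maxC; apply: H; rewrite // 1?addrC // ltW.
rewrite le_max; apply/orP; left; rewrite /padic_abs (negPf x0) (negPf s0).
apply: ler_weXz2l; last first.
  rewrite lerN2.
  pose d := denq x * denq y; pose a := numq x * denq y.
  pose b := numq y * denq x.
  have d0 : d != 0 by rewrite mulf_neq0 ?denq_neq0.
  have a0 : a != 0 by rewrite mulf_neq0 ?denq_neq0 ?numq_eq0.
  have b0 : b != 0 by rewrite mulf_neq0 ?denq_neq0 ?numq_eq0.
  have Ex : x = a%:~R / d%:~R.
    by rewrite /a /d !rmorphM /= -mulf_div divff ?mulr1 ?divq_num_den // intr_eq0 denq_neq0.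
  have Ey : y = b%:~R / d%:~R.
    rewrite /b /d !rmorphM /= [X in _ / X]mulrC -mulf_div divff ?mulr1 ?divq_num_den //.
    by rewrite intr_eq0 denq_neq0.
  have Es : x + y = (a + b)%:~R / d%:~R by rewrite rmorphD /= mulrDl -Ex -Ey.
  have ab0 : a + b != 0.
    by apply: contra_neq s0 => ab; rewrite Es ab mul0r.
  move: h; rewrite Es [in padic_val y]Ey [in X in X <= _ -> _]Ex Ex !padic_val_frac //.
  rewrite !lerD2r !lez_nat => h.
  rewrite -pfactor_dvdn ?absz_gt0 //.
  suff: ((p ^ logn p `|a|)%N%:Z %| a + b)%Z by rewrite dvdzE.
  rewrite rpredD // dvdzE /=; first exact: pfactor_dvdnn.
  by rewrite pfactor_dvdn ?absz_gt0.
by rewrite ler1n prime_gt0.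
Qed.

Lemma padic_abs_pX (k : int) : padic_abs (p%:R ^ k) = p%:R ^ (- k).
Proof.
have nat_case (m : nat) : padic_abs (p%:R ^+ m) = p%:R ^- m.
  elim: m => [|m IH]; first by rewrite expr0 padic_abs1 invr1.
  rewrite exprS padic_absM // IH ?exprS invfM; congr (_ * _).
  have p0 : p%:R != 0 :> rat by rewrite gt_eqF // p_gt0.
  rewrite /padic_abs (negPf p0) -[p%:R](divr1) -[1]/(1%:~R) -[p%:R]/((p%:Z)%:~R).
  rewrite padic_val_frac //; last by rewrite eqz_nat -lt0n prime_gt0.
  by rewrite /= logn1 subr0 logn_prime // eqxx.
case: (intP k) => [|m|m]; first exact: (nat_case 0%N).
  by rewrite -exprnP nat_case -exprnN.
by rewrite -exprnN padic_absV // nat_case invrK opprK.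
Qed.

End PadicAbs.

Section CauchySequences.
Variables (p : nat) (p_pr : prime p).

Definition is_cauchy (u : nat -> rat) : Prop := forall e : rat, 0 < e ->
  exists N : nat, forall m n : nat, (N <= m)%N -> (N <= n)%N ->
    padic_abs p (u m - u n) < e.

Definition is_null (u : nat -> rat) : Prop := forall e : rat, 0 < e ->
  exists N : nat, forall n : nat, (N <= n)%N -> padic_abs p (u n) < e.

Lemma is_cauchy_cst a : is_cauchy (fun=> a).
Proof. by move=> e e0; exists 0%N => m n _ _; rewrite subrr padic_abs0. Qed.

Lemma is_cauchyB u v : is_cauchy u -> is_cauchy v -> is_cauchy (u - v).
Proof.
move=> cu cv e e0; have [N hN] := cu e e0; have [M hM] := cv e e0.
exists (maxn N M) => m n; rewrite !geq_max => /andP[Nm Mm] /andP[Nn Mn].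
have -> : (u - v) m - (u - v) n = (u m - u n) + - (v m - v n).
  by change (u m - v m - (u n - v n) = u m - u n + - (v m - v n)); ring.
apply: le_lt_trans (padic_abs_ultra p_pr _ _) _.
by rewrite padic_absN gt_max hN // hM.
Qed.

Lemma is_cauchy_bound u : is_cauchy u ->
  exists2 B, 0 < B & exists N, forall n, (N <= n)%N -> padic_abs p (u n) < B.
Proof.
move=> cu; have [N hN] := cu 1 ltr01.
exists (padic_abs p (u N) + 1); first by rewrite ltr_wpDl // padic_abs_ge0.
exists N => n Nn; rewrite -[u n](subrK (u N)).
apply: le_lt_trans (padic_abs_ultra p_pr _ _) _.
by rewrite gt_max ltrDl ltr01 andbT ltr_wpDl ?padic_abs_ge0 ?hN.
Qed.

Lemma is_cauchyM u v : is_cauchy u -> is_cauchy v -> is_cauchy (u * v).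
Proof.
move=> cu cv e e0.
have [B B0 [N1 hB]] := is_cauchy_bound cu; have [C C0 [N2 hC]] := is_cauchy_bound cv.
have [N3 hu] := cu (e / C) (divr_gt0 e0 C0).
have [N4 hv] := cv (e / B) (divr_gt0 e0 B0).
exists (maxn (maxn N1 N2) (maxn N3 N4)) => m n.
rewrite !geq_max => /andP[/andP[m1 m2] /andP[m3 m4]] /andP[/andP[n1 n2] /andP[n3 n4]].
have -> : (u * v) m - (u * v) n = (u m - u n) * v m + u n * (v m - v n).
  by change (u m * v m - u n * v n = (u m - u n) * v m + u n * (v m - v n)); ring.
apply: le_lt_trans (padic_abs_ultra p_pr _ _) _.
rewrite gt_max !padic_absM //; apply/andP; split.
  rewrite -[e](divfK (lt0r_neq0 C0)).
  by rewrite ltr_pM ?padic_abs_ge0 ?hu ?hC.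
rewrite -[e](divfK (lt0r_neq0 B0)) mulrC.
by rewrite ltr_pM ?padic_abs_ge0 ?hv ?hB.
Qed.

Lemma is_cauchy_stable u : is_cauchy u -> ~ is_null u ->
  exists2 c, 0 < c & exists N, forall n, (N <= n)%N -> padic_abs p (u n) = c.
Proof.
move=> cu nu.
have [e e0 he] : exists2 e : rat, 0 < e &
    forall N, exists2 n, (N <= n)%N & e <= padic_abs p (u n).
  apply: contrapT => H; apply: nu => e e0; apply: contrapT => H'.
  apply: H; exists e => // N; apply: contrapT => H''.
  apply: H'; exists N => n Nn; rewrite ltNge; apply/negP => le.
  by apply: H''; exists n.
have [N hN] := cu e e0; have [k Nk ek] := he N.
exists (padic_abs p (u k)); first exact: lt_le_trans e0 ek.
exists N => n Nn; apply/eqP; rewrite eq_le; apply/andP; split.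
  rewrite -[u n](subrK (u k)); apply: le_trans (padic_abs_ultra p_pr _ _) _.
  by rewrite ge_max lexx andbT (le_trans _ ek) // ltW // hN.
have := padic_abs_ultra p_pr (u k - u n) (u n).
rewrite subrK le_max => /orP[h|//].
by have := lt_le_trans (hN _ _ Nk Nn) ek; rewrite ltNge h.
Qed.

Lemma is_cauchyV u : is_cauchy u -> ~ is_null u -> is_cauchy (fun n => (u n)^-1).
Proof.
move=> cu nu e e0; have [c c0 [N hc]] := is_cauchy_stable cu nu.
have [M hM] := cu (e * (c * c)) (mulr_gt0 e0 (mulr_gt0 c0 c0)).
exists (maxn N M) => m n; rewrite !geq_max => /andP[Nm Mm] /andP[Nn Mn].
have um0 : u m != 0 by rewrite -(padic_abs_eq0 p_pr) hc // gt_eqF.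
have un0 : u n != 0 by rewrite -(padic_abs_eq0 p_pr) hc // gt_eqF.
have -> : (u m)^-1 - (u n)^-1 = (u n - u m) / (u m * u n) by field; exact/andP.
rewrite padic_absM // padic_absV // padic_absM // !hc //.
by rewrite ltr_pdivrMr ?mulr_gt0 // hM.
Qed.

Lemma is_nullM u v : is_cauchy u -> is_cauchy v ->
  is_null (u * v) -> is_null u \/ is_null v.
Proof.
move=> cu cv nuv; apply: contrapT => /not_orP[nu nv].
have [c c0 [N hc]] := is_cauchy_stable cu nu.
have [d d0 [M hd]] := is_cauchy_stable cv nv.
have [K hK] := nuv (c * d) (mulr_gt0 c0 d0).
pose n := maxn K (maxn N M).
have Nn : (N <= n)%N by rewrite !leq_max leqnn orbT.
have Mn : (M <= n)%N by rewrite !leq_max leqnn !orbT.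
have := hK n (leq_maxl _ _).
have -> : (u * v) n = u n * v n by [].
by rewrite padic_absM // hc // hd // ltxx.
Qed.

(* The primality proof is not used here: it is a parameter of the carriers
   [cauchy_seq] and [Qp], so that their ring structures, which do need it, can
   be inferred. *)
Definition cauchy_pred of prime p : {pred nat -> rat} := fun u => `[< is_cauchy u >].

Lemma cauchy_pred_subring : subring_closed (cauchy_pred p_pr).
Proof.
split; first by apply/asboolP; exact: is_cauchy_cst.
  by move=> u v /asboolP cu /asboolP cv; apply/asboolP; exact: is_cauchyB.
by move=> u v /asboolP cu /asboolP cv; apply/asboolP; exact: is_cauchyM.
Qed.

HB.instance Definition _ :=
  GRing.isSubringClosed.Build (nat -> rat) (cauchy_pred p_pr) cauchy_pred_subring.

Record cauchy_seq (hp : prime p) :=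
  CauchySeq { cseq :> nat -> rat; _ : cseq \in cauchy_pred hp }.

HB.instance Definition _ := [isSub for @cseq p_pr].
HB.instance Definition _ := [Choice of cauchy_seq p_pr by <:].
HB.instance Definition _ := [SubChoice_isSubComNzRing of cauchy_seq p_pr by <:].

Lemma cauchy_seqP (u : cauchy_seq p_pr) : is_cauchy u.
Proof. by case: u => u /= /asboolP. Qed.

Definition null_pred : {pred cauchy_seq p_pr} := fun u => `[< is_null u >].

Lemma null_pred_idealr : idealr_closed null_pred.
Proof.
split.
- by apply/asboolP => e e0; exists 0%N => n _; rewrite [cseq 0 n]/(0 : rat) padic_abs0.
- apply/asboolP => /(_ 1 ltr01)[N /(_ N (leqnn N))].
  by rewrite [cseq 1 N]/(1 : rat) padic_abs1 ltxx.
- move=> a u v /asboolP nu /asboolP nv; apply/asboolP => e e0.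
  have [B B0 [K hB]] := is_cauchy_bound (@cauchy_seqP a).
  have [N hN] := nu (e / B) (divr_gt0 e0 B0); have [M hM] := nv e e0.
  exists (maxn K (maxn N M)) => n; rewrite !geq_max => /and3P[Kn Nn Mn].
  rewrite [cseq (a * u + v) n]/(a n * u n + v n).
  apply: le_lt_trans (padic_abs_ultra p_pr _ _) _.
  rewrite gt_max hM // andbT padic_absM // -[e](divfK (lt0r_neq0 B0)) mulrC.
  by rewrite ltr_pM ?padic_abs_ge0 ?hN ?hB.
Qed.

HB.instance Definition _ := isIdealr.Build (cauchy_seq p_pr) null_pred null_pred_idealr.

(* The field of p-adic numbers, as the completion of the rationals for
   [padic_abs p]: Cauchy sequences modulo null sequences. *)
Definition Qp := {ideal_quot null_pred}.

HB.instance Definition _ := GRing.ComNzRing.on Qp.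

Local Open Scope quotient_scope.

Let is_null_nP (u : cauchy_seq p_pr) :
  reflect (is_null u) (\pi_Qp u == 0 :> Qp).
Proof.
have -> : (0 : Qp) = \pi_Qp 0 by rewrite pi_zeror.
rewrite -Quotient.idealrBE subr0; exact: asboolP.
Qed.

Definition Qp_inv (x : Qp) : Qp :=
  if x == 0 then 0
  else \pi_Qp (insubd (0 : cauchy_seq p_pr) (fun n => (repr x n)^-1)).

Lemma Qp_mulVf x : x != 0 -> Qp_inv x * x = 1.
Proof.
move=> x0; rewrite /Qp_inv (negPf x0) -[x in _ * x]reprK.
have nx : ~ is_null (repr x) by move/is_null_nP; rewrite reprK (negPf x0).
have cx := cauchy_seqP (repr x).
have -> : (1 : Qp) = \pi_Qp 1 by rewrite pi_oner.
rewrite -pi_mulr; apply/eqP; rewrite -Quotient.idealrBE.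
apply/asboolP => e e0; have [c c0 [N hN]] := is_cauchy_stable cx nx.
exists N => n Nn; set v := insubd _ _.
have ev : v n = (repr x n)^-1.
  by rewrite /v -[cseq _]/(val _) insubdK //; apply/asboolP/is_cauchyV.
rewrite [cseq (_ - _) n]/(v n * repr x n - 1) ev mulVf ?subrr ?padic_abs0 //.
by rewrite -(padic_abs_eq0 p_pr) hN // gt_eqF.
Qed.

Lemma Qp_inv0 : Qp_inv 0 = 0.
Proof. by rewrite /Qp_inv eqxx. Qed.

HB.instance Definition _ := GRing.ComNzRing_isField.Build Qp Qp_mulVf Qp_inv0.

(* The extension of [padic_abs p] to the completion by continuity. *)
Definition Qp_abs (x : Qp) : rat :=
  lim ((fun n => padic_abs p (repr x n) : rat^o) @ \oo).

Let cvg_Qp_abs (u : nat -> rat) l : (u : nat -> rat^o) @ \oo --> (l : rat^o) ->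
  lim ((u : nat -> rat^o) @ \oo) = l.
Proof. by move=> /cvg_lim; apply; exact: Rhausdorff. Qed.

Let null_repr (u : cauchy_seq p_pr) : is_null (u - repr (\pi_Qp u) : cauchy_seq p_pr).
Proof. by apply/is_null_nP; rewrite pi_addr pi_oppr reprK subrr. Qed.

Lemma Qp_abs_null (u : cauchy_seq p_pr) : is_null u -> Qp_abs (\pi_Qp u) = 0.
Proof.
move=> nu; have := nu; move/is_null_nP/eqP => E.
have nr : is_null (repr (\pi_Qp u)) by apply/is_null_nP; rewrite reprK E.
apply: cvg_Qp_abs; apply/cvgrPdist_lt => e e0; have [N hN] := nr e e0.
exists N => // n /= Nn; rewrite sub0r normrN ger0_norm ?padic_abs_ge0 //.
exact: hN.
Qed.

Lemma Qp_abs_stable (u : cauchy_seq p_pr) : ~ is_null u ->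
  exists N, forall n, (N <= n)%N -> padic_abs p (u n) = Qp_abs (\pi_Qp u).
Proof.
move=> nu; have cu := cauchy_seqP u.
have [c c0 [N hN]] := is_cauchy_stable cu nu.
have [M hM] := @null_repr u c c0.
suff -> : Qp_abs (\pi_Qp u) = c by exists N.
apply: cvg_Qp_abs; apply/cvgrPdist_lt => e e0.
exists (maxn N M) => // n /=; rewrite geq_max => /andP[Nn Mn].
suff -> : padic_abs p (repr (\pi_Qp u) n) = c by rewrite subrr normr0.
have h := hM n Mn; rewrite [cseq (_ - _) n]/(u n - repr (\pi_Qp u) n) in h.
set r := repr (\pi_Qp u) n in h *; apply/eqP; rewrite eq_le; apply/andP; split.
  rewrite -[r](subKr (u n)); apply: le_trans (padic_abs_ultra p_pr _ _) _.
  by rewrite padic_absN ge_max (hN _ Nn) lexx /= ltW.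
have := padic_abs_ultra p_pr (u n - r) r.
by rewrite subrK hN // le_max leNgt h.
Qed.

Lemma Qp_abs0 : Qp_abs 0 = 0.
Proof.
have -> : (0 : Qp) = \pi_Qp 0 by rewrite pi_zeror.
by apply: Qp_abs_null; apply/is_null_nP; rewrite pi_zeror.
Qed.

Let nnull_repr (x : Qp) : x != 0 -> ~ is_null (repr x).
Proof. by move=> x0 /is_null_nP; rewrite reprK (negPf x0). Qed.

Let abs_repr (x : Qp) : x != 0 ->
  exists N, forall n, (N <= n)%N -> padic_abs p (repr x n) = Qp_abs x.
Proof. by move=> /nnull_repr/Qp_abs_stable; rewrite reprK. Qed.

Lemma Qp_abs_ge0 x : 0 <= Qp_abs x.
Proof.
case: (eqVneq x 0) => [->|x0]; first by rewrite Qp_abs0.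
by have [N hN] := abs_repr x0; rewrite -(hN N) // padic_abs_ge0.
Qed.

Lemma Qp_abs_eq0 x : (Qp_abs x == 0) = (x == 0).
Proof.
case: (eqVneq x 0) => [->|x0]; first by rewrite Qp_abs0 eqxx.
have [N hN] := abs_repr x0.
have [c c0 [M hM]] := is_cauchy_stable (cauchy_seqP (repr x)) (nnull_repr x0).
rewrite -(hN (maxn N M)) ?leq_maxl // hM ?leq_maxr //.
exact: gt_eqF.
Qed.

Lemma Qp_absM x y : Qp_abs (x * y) = Qp_abs x * Qp_abs y.
Proof.
case: (eqVneq x 0) => [->|x0]; first by rewrite !(mul0r, Qp_abs0).
case: (eqVneq y 0) => [->|y0]; first by rewrite !(mulr0, Qp_abs0).
have [N hN] := abs_repr x0; have [M hM] := abs_repr y0.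
have E : x * y = \pi_Qp (repr x * repr y) by rewrite pi_mulr !reprK.
have nz : ~ is_null (repr x * repr y : cauchy_seq p_pr).
  by move/is_null_nP; rewrite -E mulf_eq0 (negPf x0) (negPf y0).
have [K hK] := Qp_abs_stable nz; pose n := maxn N (maxn M K).
have hx : padic_abs p (repr x n) = Qp_abs x by apply: hN; rewrite leq_maxl.
have hy : padic_abs p (repr y n) = Qp_abs y.
  by apply: hM; rewrite !leq_max leqnn orbT.
have hxy : padic_abs p (repr x n * repr y n) = Qp_abs (x * y).
  by rewrite [in RHS]E; apply: hK; rewrite !leq_max leqnn !orbT.
by move: hxy; rewrite padic_absM // hx hy.
Qed.

Lemma Qp_abs_ultra x y : Qp_abs (x + y) <= Num.max (Qp_abs x) (Qp_abs y).
Proof.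
case: (eqVneq x 0) => [->|x0]; first by rewrite add0r le_max lexx orbT.
case: (eqVneq y 0) => [->|y0]; first by rewrite addr0 le_max lexx.
case: (eqVneq (x + y) 0) => [->|s0]; first by rewrite Qp_abs0 le_max Qp_abs_ge0.
have [N hN] := abs_repr x0; have [M hM] := abs_repr y0.
have E : x + y = \pi_Qp (repr x + repr y) by rewrite pi_addr !reprK.
have nz : ~ is_null (repr x + repr y : cauchy_seq p_pr).
  by move/is_null_nP; rewrite -E (negPf s0).
have [K hK] := Qp_abs_stable nz; pose n := maxn N (maxn M K).
have hx : padic_abs p (repr x n) = Qp_abs x by apply: hN; rewrite leq_maxl.
have hy : padic_abs p (repr y n) = Qp_abs y.
  by apply: hM; rewrite !leq_max leqnn orbT.
have hxy : padic_abs p (repr x n + repr y n) = Qp_abs (x + y).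
  by rewrite [in RHS]E; apply: hK; rewrite !leq_max leqnn !orbT.
by move: (padic_abs_ultra p_pr (repr x n) (repr y n)); rewrite hx hy hxy.
Qed.

Definition Qp_of_rat (a : rat) : Qp :=
  \pi_Qp (@CauchySeq p_pr (fun=> a) (asboolT (is_cauchy_cst a))).

Lemma Qp_abs_of_rat a : Qp_abs (Qp_of_rat a) = padic_abs p a.
Proof.
case: (pselect (is_null (fun=> a))) => na.
  rewrite Qp_abs_null //; case: (eqVneq a 0) => [->|a0]; first by rewrite padic_abs0.
  have a1 : 0 < padic_abs p a by rewrite padic_abs_gt0.
  by have [N /(_ N (leqnn N))] := na _ a1; rewrite ltxx.
have [N hN] := @Qp_abs_stable (@CauchySeq p_pr (fun=> a) (asboolT (is_cauchy_cst a))) na.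
by rewrite -(hN N).
Qed.

Lemma Qp_of_ratB : {morph Qp_of_rat : a b / a - b}.
Proof.
move=> a b; rewrite /Qp_of_rat -pi_oppr -pi_addr; congr (\pi_Qp _).
exact: val_inj.
Qed.

Lemma Qp_of_ratM : {morph Qp_of_rat : a b / a * b}.
Proof.
move=> a b; rewrite /Qp_of_rat -pi_mulr; congr (\pi_Qp _); exact: val_inj.
Qed.

Lemma Qp_of_rat1 : Qp_of_rat 1 = 1.
Proof.
have -> : (1 : Qp) = \pi_Qp 1 by rewrite pi_oner.
congr (\pi_Qp _); exact: val_inj.
Qed.

HB.instance Definition _ := GRing.isZmodMorphism.Build rat Qp Qp_of_rat Qp_of_ratB.
HB.instance Definition _ :=
  GRing.isMonoidMorphism.Build rat Qp Qp_of_rat (Qp_of_rat1, Qp_of_ratM).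

Lemma Qp_abs_ratr a : Qp_abs (ratr a) = padic_abs p a.
Proof. by rewrite -(fmorph_eq_rat Qp_of_rat) Qp_abs_of_rat. Qed.

Lemma Qp_absN x : Qp_abs (- x) = Qp_abs x.
Proof.
rewrite -mulN1r Qp_absM.
have <- : Qp_of_rat (-1) = -1 :> Qp by rewrite rmorphN rmorph1.
by rewrite Qp_abs_of_rat padic_absN padic_abs1 mul1r.
Qed.

Lemma Qp_abs_pX x : x != 0 -> exists k : int, Qp_abs x = p%:R ^ k.
Proof.
move=> x0; have [N hN] := abs_repr x0; exists (- padic_val p (repr x N)).
have := Qp_abs_eq0 x; rewrite -(hN N) // (negPf x0) padic_abs_eq0 // => rx0.
by rewrite /padic_abs rx0.
Qed.

Definition Qp_dist (x y : Qp) := Qp_abs (x - y).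

Lemma Qp_distxx x : Qp_dist x x = 0.
Proof. by rewrite /Qp_dist subrr Qp_abs0. Qed.

Lemma Qp_dist_positivity x y : Qp_dist x y = 0 -> x = y.
Proof. by move/eqP; rewrite Qp_abs_eq0 subr_eq0 => /eqP. Qed.

Lemma Qp_dist_sym x y : Qp_dist x y = Qp_dist y x.
Proof. by rewrite /Qp_dist -opprB Qp_absN. Qed.

Lemma Qp_dist_triangle y x z : Qp_dist x z <= Qp_dist x y + Qp_dist y z.
Proof.
rewrite /Qp_dist -[x - z](subrKA y); apply: le_trans (Qp_abs_ultra _ _) _.
by rewrite ge_max lerDl lerDr !Qp_abs_ge0.
Qed.

HB.instance Definition _ := isMetric.Build rat Qp
  Qp_distxx Qp_dist_positivity Qp_dist_sym Qp_dist_triangle.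

End CauchySequences.

Section SpecialLinear.
Variables (K : fieldType) (n : nat).

Definition SL_set : set 'M[K]_n := [set A | \det A = 1].

Definition SL := set_type SL_set.

Definition mx_of_SL (T : SL) : 'M[K]_n := val (T : set_type SL_set).
Coercion mx_of_SL : SL >-> matrix.

HB.instance Definition _ := Choice.on SL.

Implicit Types T U : SL.

Lemma SL_det T : \det T = 1.
Proof. exact: (@set_valP _ SL_set T). Qed.

Lemma SL_unit T : (T : 'M[K]_n) \in unitmx.
Proof. by rewrite unitmxE SL_det unitr1. Qed.

Definition mkSL (A : 'M[K]_n) (h : \det A = 1) : SL := SigSub (mem_set h).

Lemma SL_one_subproof : \det (1%:M : 'M[K]_n) = 1. Proof. exact: det1. Qed.
Lemma SL_mul_subproof T U : \det (T *m U) = 1.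
Proof. by rewrite det_mulmx !SL_det mulr1. Qed.
Lemma SL_inv_subproof T : \det (invmx T) = 1.
Proof. by rewrite det_inv SL_det invr1. Qed.

Definition SL_one := mkSL SL_one_subproof.
Definition SL_mul T U := mkSL (SL_mul_subproof T U).
Definition SL_inv T := mkSL (SL_inv_subproof T).

Fact SL_mulA : associative SL_mul.
Proof. by move=> T U V; apply: val_inj; rewrite /= mulmxA. Qed.
Fact SL_mul1 : left_id SL_one SL_mul.
Proof. by move=> T; apply: val_inj; rewrite /= mul1mx. Qed.
Fact SL_1mul : right_id SL_one SL_mul.
Proof. by move=> T; apply: val_inj; rewrite /= mulmx1. Qed.
Fact SL_mulV : left_inverse SL_one SL_inv SL_mul.
Proof. by move=> T; apply: val_inj; rewrite /= mulVmx // SL_unit. Qed.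
Fact SL_Vmul : right_inverse SL_one SL_inv SL_mul.
Proof. by move=> T; apply: val_inj; rewrite /= mulmxV // SL_unit. Qed.

HB.instance Definition _ := isGroup.Build SL
  SL_mulA SL_mul1 SL_1mul SL_mulV SL_Vmul.

End SpecialLinear.

Section Sphere.
Variables (p : nat) (hp : prime p).
Local Notation K := (Qp hp).

Section Vector.
Variable n : nat.
Implicit Type x : 'cV[K]_n.

Definition vnorm x : rat := \big[Num.max/0]_(i < n) Qp_abs (x i 0).

Lemma vnorm_ge0 x : 0 <= vnorm x.
Proof. by rewrite /vnorm; elim/big_rec: _ => // i y _ h; rewrite le_max h orbT. Qed.

Lemma vnormP x : vnorm x = 0 \/ exists i, vnorm x = Qp_abs (x i 0).
Proof.
rewrite /vnorm; elim/big_rec: _ => [|i y _ [->|[j ->]]]; first by left.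
  by right; exists i; apply/max_idPl; exact: Qp_abs_ge0.
right; case: (leP (Qp_abs (x i 0)) (Qp_abs (x j 0))) => h; [by exists j|by exists i].
Qed.

Lemma vnorm_ge x i : Qp_abs (x i 0) <= vnorm x.
Proof. exact: le_bigmax. Qed.

Lemma vnorm_eq0 x : (vnorm x == 0) = (x == 0).
Proof.
apply/eqP/eqP => [x0|->].
  apply/colP => i; rewrite mxE; apply/eqP; rewrite -Qp_abs_eq0 eq_le Qp_abs_ge0 andbT.
  by rewrite -x0 vnorm_ge.
by have [//|[i ->]] := vnormP 0; rewrite mxE Qp_abs0.
Qed.

Lemma vnormZ a x : vnorm (a *: x) = Qp_abs a * vnorm x.
Proof.
rewrite /vnorm; elim/big_rec2: _ => [|i y z _ ->]; first by rewrite mulr0.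
by rewrite mxE Qp_absM maxr_pMr // Qp_abs_ge0.
Qed.

(* The rational ||x||_p, a power of p when x <> 0, is turned into a p-adic scalar
   by the inclusion [ratr] of the rationals into [K]; since |p^m|_p = p^-m, this
   has norm 1. *)
Definition normalize x : 'cV[K]_n := ratr (vnorm x) *: x.

Lemma vnorm_normalize x : x != 0 -> vnorm (normalize x) = 1.
Proof.
move=> x0; rewrite vnormZ Qp_abs_ratr.
have [x00|[i xi]] := vnormP x; first by rewrite -vnorm_eq0 x00 eqxx in x0.
have [|k Ek] := @Qp_abs_pX _ hp (x i 0); first by rewrite -Qp_abs_eq0 -xi vnorm_eq0.
rewrite xi Ek padic_abs_pX // -expfzDr ?addNr ?expr0z //.
by rewrite gt_eqF // p_gt0.
Qed.

Definition sphere_set : set 'cV[K]_n := [set x | vnorm x = 1].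

End Vector.

(* The sphere and SL(n) get the subspace topology from [set_type], the ambient
   matrix spaces having the entrywise topology. *)
Definition sphere n := set_type (@sphere_set n).
HB.instance Definition _ n := Topological.on (sphere n).

HB.instance Definition _ n := Topological.copy (SL K n) (set_type (@SL_set K n)).

Definition cV_of_sphere n (x : sphere n) : 'cV[K]_n :=
  val (x : set_type (@sphere_set n)).
Coercion cV_of_sphere : sphere >-> matrix.

Section Action.
Variable n : nat.
Implicit Types (T : SL K n) (x : sphere n).

Lemma vnorm_sphere x : vnorm x = 1.
Proof. exact: (@set_valP _ (@sphere_set n) x). Qed.

Lemma sphere_action_subproof T x : vnorm (normalize (T *m x)) = 1.
Proof.
apply: vnorm_normalize; apply/eqP => Tx0.
have : x = 0 :> 'cV[K]_n by rewrite -(mulKmx (SL_unit T) x) Tx0 mulmx0.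
by move/eqP; rewrite -vnorm_eq0 vnorm_sphere oner_eq0.
Qed.

Definition sphere_action T x : sphere n :=
  SigSub (mem_set (sphere_action_subproof T x)).

Lemma sphere_action1 x : sphere_action 1%g x = x.
Proof.
apply: val_inj; rewrite /= mul1mx /normalize.
by rewrite vnorm_sphere -(fmorph_eq_rat (@Qp_of_rat _ hp)) rmorph1 scale1r.
Qed.

Lemma sphere_actionM (T U : SL K n) x :
  sphere_action (T * U)%g x = sphere_action T (sphere_action U x).
Proof.
apply: val_inj; rewrite /= -mulmxA; set v := U *m x : 'cV[K]_n.
rewrite /normalize -!scalemxAr vnormZ Qp_abs_ratr.
have nv : padic_abs p (vnorm v) * vnorm v = 1.
  have := sphere_action_subproof U x.
  by rewrite vnormZ Qp_abs_ratr.
rewrite scalerA -!(fmorph_eq_rat (@Qp_of_rat _ hp)) -rmorphM mulrAC nv mul1r.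
by [].
Qed.

End Action.
End Sphere.

Definition acts_distally (X : topologicalType) (H : set (X -> X)) : Prop :=
  forall x y : X, x <> y ->
    closure [set (h x, h y) | h in H] `&` diagonal = set0.

Definition is_semigroup (G : groupType) (S : set G) : Prop :=
  S !=set0 /\ forall g h, S g -> S h -> S (g * h)%g.

Definition is_subgroup (G : groupType) (S : set G) : Prop :=
  [/\ S 1%g, forall g h, S g -> S h -> S (g * h)%g & forall g, S g -> S (g^-1)%g].

Definition acts_distally_on_sphere p (hp : prime p) n (S : set (SL (Qp hp) n)) :=
  acts_distally [set sphere_action T | T in S].

(* Main.v *)
(* If S is unbounded, rescale a sequence T_k of S with norms tending to infinity
   by powers of p to matrices of norm 1. By compactness they have a cluster point
   A; it is nonzero, but det A = 0 since the rescaled determinants tend to 0. Take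
   x <> 0 with A x = 0 and y of norm 1 with A y <> 0, the norm of x being < 1: the
   images of the distinct points y and y + x of the sphere both cluster at A y
   normalized, so S is not distal. If S is bounded, its closure is compact by the
   local compactness of Q_p, and a power T^m close to T^-1 is found among the
   quotients of close powers of T. Conversely, if the closure is compact, a
   sequence of S driving x and y to the same point has a cluster point T with
   T x = T y on the sphere, whence x = y. *)

Require Import Defs.
From mathcomp Require Import all_boot all_order perm all_algebra ring lra.
From mathcomp Require Import all_classical.
From mathcomp Require Import topology normedtype.

Set Implicit Arguments.
Unset Strict Implicit.
Unset Printing Implicit Defensive.

Import Order.TTheory GRing.Theory Num.Theory.

Local Open Scope classical_set_scope.
Local Open Scope ring_scope.

(** * Approximation by integers and completeness of the p-adic numbers *)

Section Padic.
Variables (p : nat) (hp : prime p).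
Local Notation K := (Qp hp).
Implicit Types x y : K.

Lemma padic_abs_nat_le (m n : nat) :
  (p ^ n %| m)%N -> padic_abs p m%:R <= p%:R ^- n.
Proof.
case: (posnP m) => [->|m0 dv].
  by rewrite padic_abs0 invr_ge0 exprn_ge0 // ler0n.
rewrite /padic_abs pnatr_eq0 -[m == 0]negbK -lt0n m0 /=.
have E : m%:R = (m%:Z)%:~R / 1%:~R :> rat by rewrite divr1.
rewrite E padic_val_frac ?eqz_nat -?lt0n //= logn1 subr0 -exprnN.
rewrite ler_pV2 ?inE ?unitfE ?exprn_gt0 ?expf_neq0 ?gt_eqF ?p_gt0 //.
by rewrite ler_weXn2l ?ler1n ?prime_gt0 // -pfactor_dvdn.
Qed.

Lemma padic_abs_int (z : int) : padic_abs p z%:~R = padic_abs p `|z|%N%:R.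
Proof.
case: z => m; first by [].
by rewrite NegzE rmorphN padic_absN.
Qed.

Lemma padic_abs_le1_coprime (a : rat) : padic_abs p a <= 1 -> coprime p `|denq a|.
Proof.
move=> a1; rewrite prime_coprime //; apply/negP => pd.
have a0 : a != 0.
  by apply: contraTneq pd => ->; rewrite gtnNdvd // prime_gt1.
have pN : ~~ (p %| `|numq a|)%N.
  apply/negP => pN; have : (p %| gcdn `|numq a| `|denq a|)%N by rewrite dvdn_gcd pN.
  by rewrite (eqP (coprime_num_den a)) dvdn1 => /eqP p1; move: hp; rewrite p1.
move: a1; rewrite /padic_abs (negPf a0) /padic_val.
have -> : logn p `|numq a| = 0%N.
  by apply/eqP; rewrite -leqn0 leqNgt logn_gt0 mem_primes (negPf pN) !andbF.
have : (0 < logn p `|denq a|)%N.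
  by rewrite logn_gt0 mem_primes hp pd absz_gt0 denq_neq0.
case: (logn p _) => // m _; rewrite sub0r opprK -exprnP.
rewrite leNgt => /negP; apply.
by rewrite exprn_egt1 // ltr1n prime_gt1.
Qed.

Lemma padic_abs_coprime (m : nat) : coprime p m -> padic_abs p m%:R = 1.
Proof.
move=> cm; have m0 : (0 < m)%N.
  by rewrite lt0n; apply: contraTneq cm => ->; rewrite /coprime gcdn0 gtn_eqF // prime_gt1.
rewrite /padic_abs pnatr_eq0 -[m == 0]negbK -lt0n m0 /=.
have E : m%:R = (m%:Z)%:~R / 1%:~R :> rat by rewrite divr1.
rewrite E padic_val_frac ?eqz_nat -?lt0n //= logn1 subr0.
by rewrite logn_coprime.
Qed.

(** Modulo p^n the denominator is invertible; the numerator times that inverse, reduced modulo p^n,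
    is the wanted residue. *)
Lemma padic_abs_approx_nat (a : rat) (n : nat) : padic_abs p a <= 1 ->
  exists k : 'I_(p ^ n), padic_abs p (a - k%:R) <= p%:R ^- n.
Proof.
move=> /padic_abs_le1_coprime cop; set d := `|denq a|%N in cop.
have pn0 : (0 < p ^ n)%N by rewrite expn_gt0 prime_gt0.
have pz : ((p ^ n)%N%:Z != 0) by rewrite eqz_nat -lt0n.
have Ed : denq a = d%:Z by rewrite /d gez0_abs // denq_ge0.
have cz : coprimez (p ^ n)%N%:Z d%:Z by rewrite /coprimez /gcdz /= eqz_nat; exact: coprimeXl.
have [[u v] /= Euv] := coprimezP _ _ cz.
pose k := (numq a * v %% (p ^ n)%N%:Z)%Z.
have k0 : 0 <= k by rewrite modz_ge0.
have kn : (`|k| < p ^ n)%N by rewrite -ltz_nat gez0_abs // ltz_pmod // ltz_nat.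
exists (Ordinal kn) => /=.
(* By the choice of [k] and the Bezout relation, each of the two terms below is a multiple of
   p^n. *)
have dv : ((p ^ n)%N%:Z %| numq a - k * d%:Z)%Z.
  have -> : numq a - k * d%:Z = (numq a * v - k) * d%:Z + numq a * (1 - v * d%:Z).
    by ring.
  rewrite rpredD //; first by rewrite dvdz_mulr // -eqz_mod_dvd modz_mod.
  by rewrite -Euv addrK mulrA dvdz_mull.
have d0 : d%:R != 0 :> rat by rewrite pnatr_eq0 -lt0n absz_gt0 denq_neq0.
have -> : a - `|k|%:R = (numq a - k * d%:Z)%:~R / d%:R.
  rewrite rmorphB rmorphM /= mulrBl mulfK //.
  by rewrite -[a in LHS]divq_num_den Ed -[k in RHS]gez0_abs.
rewrite padic_absM // padic_absV // (padic_abs_coprime cop) invr1 mulr1.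
by rewrite padic_abs_int; exact: padic_abs_nat_le.
Qed.

(** Along a non-null representative the absolute value is eventually constant and equal to that of
    the class, so a bound on a tail passes to the class. *)
Lemma Qp_abs_pi_le (u : cauchy_seq hp) (e : rat) (N : nat) : 0 <= e ->
  (forall n, (N <= n)%N -> padic_abs p (u n) <= e) ->
  Qp_abs (\pi_(Qp hp)%qT u) <= e.
Proof.
move=> e0 hN; have [nul|nul] := pselect (is_null p u).
  by rewrite Qp_abs_null.
have [M /(_ (maxn M N) (leq_maxl _ _)) <-] := Qp_abs_stable nul.
by apply: hN; rewrite leq_maxr.
Qed.

Let cst (a : rat) := @CauchySeq p hp (fun=> a) (asboolT (is_cauchy_cst p a)).

Lemma Qp_approx_rat x (e : rat) : 0 < e ->
  exists a : rat, Qp_abs (x - Qp_of_rat hp a) <= e.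
Proof.
move=> e0; have [N hN] := cauchy_seqP (repr x)%qT e0; exists (repr x N)%qT.
have -> : x - Qp_of_rat hp (repr x N)%qT
    = (\pi_(Qp hp) (repr x - cst (repr x N)))%qT.
  by rewrite pi_addr pi_oppr reprK.
by apply: (@Qp_abs_pi_le _ _ N (ltW e0)) => n Nn; apply/ltW/hN.
Qed.

Lemma pXN_gt0 n : 0 < p%:R ^- n :> rat.
Proof. by rewrite invr_gt0 exprn_gt0 // p_gt0. Qed.

(** Total boundedness of the unit ball, the source of all compactness below. A rational
    approximation of [x] stays in the unit ball by the ultrametric inequality, and is then reduced
    modulo p^n. *)
Lemma Qp_approx_nat x (n : nat) : Qp_abs x <= 1 ->
  exists k : 'I_(p ^ n), Qp_abs (x - Qp_of_rat hp k%:R) <= p%:R ^- n.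
Proof.
move=> x1; have [a ha] := Qp_approx_rat x (pXN_gt0 n).
have pn1 : p%:R ^- n <= 1 :> rat.
  by rewrite invf_le1 ?exprn_gt0 ?p_gt0 // exprn_ege1 // ler1n prime_gt0.
have /(padic_abs_approx_nat n)[k hk] : padic_abs p a <= 1.
  rewrite -(Qp_abs_of_rat hp) -[Qp_of_rat hp a](subKr x).
  apply: le_trans (Qp_abs_ultra _ _) _.
  by rewrite Qp_absN ge_max x1 /= (le_trans ha).
exists k; rewrite -[x](subrK (Qp_of_rat hp a)) -addrA -rmorphB.
apply: le_trans (Qp_abs_ultra _ _) _.
by rewrite ge_max ha /= Qp_abs_of_rat.
Qed.

Lemma pXN_lt (e : rat) : 0 < e -> exists n, p%:R ^- n < e.
Proof.
move=> e0; have [n hn] : exists n : nat, e^-1 < n%:R.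
  by exists (Num.bound e^-1); apply: archi_boundP; rewrite invr_ge0 ltW.
exists n; rewrite invf_plt ?posrE ?exprn_gt0 ?p_gt0 //.
by apply: lt_trans hn _; rewrite -natrX ltr_nat ltn_expl // prime_gt1.
Qed.

Lemma pXN_le (m n : nat) : (m <= n)%N -> p%:R ^- n <= p%:R ^- m :> rat.
Proof.
move=> mn; rewrite lef_pV2 ?posrE ?exprn_gt0 ?p_gt0 //.
by rewrite ler_weXn2l // ler1n prime_gt0.
Qed.

(** The explicit modulus makes [u] a Cauchy sequence, whose own class is the limit. *)
Lemma Qp_complete (u : nat -> rat) :
  (forall n m, (n <= m)%N -> padic_abs p (u m - u n) <= p%:R ^- n) ->
  exists x : K, forall n, Qp_abs (x - Qp_of_rat hp (u n)) <= p%:R ^- n.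
Proof.
move=> hu; have cu : is_cauchy p u.
  move=> e /pXN_lt[N hN]; exists N => m n Nm Nn.
  apply: le_lt_trans hN; rewrite -[u m](subrK (u N)) -addrA.
  apply: le_trans (padic_abs_ultra hp _ _) _.
  by rewrite ge_max hu //= -opprB padic_absN hu.
pose v := @CauchySeq p hp u (asboolT cu); exists (\pi_(Qp hp) v)%qT => n.
have -> : (\pi_(Qp hp) v)%qT - Qp_of_rat hp (u n) = (\pi_(Qp hp) (v - cst (u n)))%qT.
  by rewrite pi_addr pi_oppr.
by apply: (@Qp_abs_pi_le _ _ n) => [|m nm]; [rewrite ltW ?pXN_gt0|exact: hu].
Qed.

(** * Limits of bounded p-adic functions along ultrafilters *)

Section UltraLimit.
Variables (T : Type) (F : set_system T).
Hypothesis FF : UltraFilter F.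

Lemma ultra_lim_Zp (f : T -> K) : (\forall t \near F, Qp_abs (f t) <= 1) ->
  exists x : K, forall e : rat, 0 < e -> \forall t \near F, Qp_abs (f t - x) < e.
Proof.
move=> f1.
(* A proper ultrafilter selects one of the finitely many residues mod p^n. *)
have digit n : exists k : nat,
    \forall t \near F, Qp_abs (f t - Qp_of_rat hp k%:R) <= p%:R ^- n.
  apply: contrapT => H.
  have : \forall t \near F, forall k : 'I_(p ^ n),
      ~ Qp_abs (f t - Qp_of_rat hp k%:R) <= p%:R ^- n.
    apply: filter_forall => k.
    have [Fk|//] := in_ultra_setVsetC
      [set t | Qp_abs (f t - Qp_of_rat hp k%:R) <= p%:R ^- n] FF.
    by case: H; exists k.
  move=> /(filterI f1)/filter_ex[t [ft1]] nk.
  by have [k hk] := Qp_approx_nat n ft1; apply: (nk k).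
have [a ha] := choice digit.
(* The residues at levels [n] and [m] are compared at a point [t] where both approximations hold. *)
have [n m nm|x hx] := Qp_complete (u := fun n => (a n)%:R).
  have [t [htn htm]] := filter_ex (filterI (ha n) (ha m)).
  rewrite -(Qp_abs_of_rat hp) rmorphB /=.
  rewrite -[Qp_of_rat hp (a m)%:R](subKr (f t)) addrAC -addrC.
  apply: le_trans (Qp_abs_ultra _ _) _.
  by rewrite Qp_absN ge_max htn andbT (le_trans htm) // pXN_le.
exists x => e /pXN_lt[n hn]; apply: filterS (ha n) => t ht.
apply: le_lt_trans hn; rewrite -[f t](subrK (Qp_of_rat hp (a n)%:R)) -addrA.
apply: le_trans (Qp_abs_ultra _ _) _.
by rewrite ge_max ht -opprB Qp_absN hx.
Qed.

(** Multiplication by a high power of p brings the values into the unit ball, and division brings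
    the limit back. *)
Lemma ultra_lim_Qp (f : T -> K) (c : rat) : (\forall t \near F, Qp_abs (f t) <= c) ->
  exists x : K, forall e : rat, 0 < e -> \forall t \near F, Qp_abs (f t - x) < e.
Proof.
move=> fc; have [n hn] : exists n : nat, p%:R ^- n * c <= 1.
  have [c0|c0] := leP c 0.
    by exists 0%N; rewrite (le_trans _ (@ler01 _)) // mulr_ge0_le0 // ltW ?pXN_gt0.
  have [|n hn] := @pXN_lt c^-1; first by rewrite invr_gt0.
  by exists n; rewrite -ler_pdivlMr // mul1r ltW.
pose q := Qp_of_rat hp (p%:R ^+ n).
have aq : Qp_abs q = p%:R ^- n by rewrite Qp_abs_of_rat exprnP padic_abs_pX // exprnN.
have q0 : q != 0 by rewrite -Qp_abs_eq0 aq gt_eqF // pXN_gt0.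
have [|x hx] := ultra_lim_Zp (f := fun t => q * f t).
  apply: filterS fc => t ht; rewrite Qp_absM aq (le_trans _ hn) //.
  by rewrite ler_wpM2l // ltW // pXN_gt0.
exists (q^-1 * x) => e e0; have := hx (p%:R ^- n * e) (mulr_gt0 (pXN_gt0 n) e0).
apply: filterS => t; rewrite -[x in q * f t - x](mulVKf q0) -mulrBr Qp_absM aq.
by rewrite ltr_pM2l // pXN_gt0.
Qed.

End UltraLimit.
End Padic.

(** * Entrywise bounds and the topology of matrices *)

Section MatrixBounds.
Variables (p : nat) (hp : prime p).
Local Notation K := (Qp hp).

(** This plays the part of a bound on the maximum norm, and describes closed balls. *)
Definition mx_le m n (c : rat) (A : 'M[K]_(m, n)) :=
  forall i j, Qp_abs (A i j) <= c.

Lemma mx_leW m n c d (A : 'M[K]_(m, n)) : c <= d -> mx_le c A -> mx_le d A.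
Proof. by move=> cd hA i j; apply: le_trans (hA i j) cd. Qed.

Lemma mx_leN m n c (A : 'M[K]_(m, n)) : mx_le c A -> mx_le c (- A).
Proof. by move=> hA i j; rewrite mxE Qp_absN. Qed.

Lemma mx_leD m n c (A B : 'M[K]_(m, n)) : mx_le c A -> mx_le c B -> mx_le c (A + B).
Proof.
move=> hA hB i j; rewrite mxE; apply: le_trans (Qp_abs_ultra _ _) _.
by rewrite ge_max hA hB.
Qed.

Lemma mx_leB_sym m n c (A B : 'M[K]_(m, n)) : mx_le c (A - B) -> mx_le c (B - A).
Proof. by rewrite -[B - A]opprB; exact: mx_leN. Qed.

Lemma mx_leB_trans m n c (B A C : 'M[K]_(m, n)) :
  mx_le c (A - B) -> mx_le c (B - C) -> mx_le c (A - C).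
Proof. by move=> hA hB; rewrite -(subrKA B); exact: mx_leD. Qed.

Lemma Qp_abs_sum_le (I : Type) (r : seq I) (P : pred I) (f : I -> K) (c : rat) :
  0 <= c -> (forall i, P i -> Qp_abs (f i) <= c) -> Qp_abs (\sum_(i <- r | P i) f i) <= c.
Proof.
move=> c0 hf; elim/big_ind: _ => [|x y hx hy|//]; first by rewrite Qp_abs0.
by apply: le_trans (Qp_abs_ultra _ _) _; rewrite ge_max hx hy.
Qed.

(** The ultrametric inequality bounds a sum by its largest term, so no factor [n] appears. *)
Lemma mx_leM m n k c d (A : 'M[K]_(m, n)) (B : 'M[K]_(n, k)) :
  0 <= c -> 0 <= d -> mx_le c A -> mx_le d B -> mx_le (c * d) (A *m B).
Proof.
move=> c0 d0 hA hB i j; rewrite mxE; apply: Qp_abs_sum_le => [|l _].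
  exact: mulr_ge0.
by rewrite Qp_absM ler_pM ?Qp_abs_ge0.
Qed.

Lemma Qp_abs1 : Qp_abs (1 : K) = 1.
Proof. by rewrite -(Qp_of_rat1 hp) Qp_abs_of_rat padic_abs1. Qed.

Lemma Qp_absX (x : K) n : Qp_abs (x ^+ n) = Qp_abs x ^+ n.
Proof. by elim: n => [|n IH]; rewrite ?Qp_abs1 // !exprS Qp_absM IH. Qed.

Lemma Qp_abs_sign n : Qp_abs ((-1) ^+ n : K) = 1.
Proof. by rewrite Qp_absX Qp_absN Qp_abs1 expr1n. Qed.

Lemma Qp_abs_prod_le (I : Type) (r : seq I) (f : I -> K) (c : rat) :
  (forall i, Qp_abs (f i) <= c) -> Qp_abs (\prod_(i <- r) f i) <= c ^+ size r.
Proof.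
move=> hf; elim: r => [|i r IH]; first by rewrite big_nil Qp_abs1.
by rewrite big_cons Qp_absM exprS ler_pM ?Qp_abs_ge0.
Qed.

(** The difference telescopes one factor at a time; as [c] is at least 1, the full power of [c] also
    bounds the shorter products that arise. *)
Lemma Qp_abs_prodB_le (I : Type) (r : seq I) (f g : I -> K) (c e : rat) :
  1 <= c -> (forall i, Qp_abs (f i) <= c) -> (forall i, Qp_abs (g i) <= c) ->
  0 <= e -> (forall i, Qp_abs (f i - g i) <= e) ->
  Qp_abs (\prod_(i <- r) f i - \prod_(i <- r) g i) <= c ^+ size r * e.
Proof.
move=> c1 hf hg e0 hfg; have c0 : 0 <= c by apply: le_trans c1.
elim: r => [|i r IH]; first by rewrite !big_nil subrr Qp_abs0 mul1r.
rewrite !big_cons; set F := \prod_(j <- r) f j; set G := \prod_(j <- r) g j.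
have -> : f i * F - g i * G = (f i - g i) * F + g i * (F - G) by ring.
apply: le_trans (Qp_abs_ultra _ _) _; rewrite ge_max !Qp_absM /= exprS.
apply/andP; split; last by rewrite -mulrA ler_pM ?Qp_abs_ge0.
rewrite mulrC ler_pM ?Qp_abs_ge0 //.
apply: le_trans (Qp_abs_prod_le r hf) _.
by rewrite ler_peMl // exprn_ge0.
Qed.

Lemma Qp_abs_det_le n (A : 'M[K]_n) (c : rat) : 0 <= c -> mx_le c A ->
  Qp_abs (\det A) <= c ^+ n.
Proof.
move=> c0 hA; apply: Qp_abs_sum_le => [|s _]; first exact: exprn_ge0.
rewrite Qp_absM Qp_abs_sign mul1r.
have := @Qp_abs_prod_le _ (index_enum 'I_n) (fun i => A i (s i)) c (fun i => hA _ _).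
by rewrite /index_enum -enumT size_enum_ord.
Qed.

Lemma Qp_abs_detB_le n (A B : 'M[K]_n) (c e : rat) : 1 <= c -> 0 <= e ->
  mx_le c A -> mx_le c B -> mx_le e (A - B) ->
  Qp_abs (\det A - \det B) <= c ^+ n * e.
Proof.
move=> c1 e0 hA hB hAB; rewrite -sumrB; have c0 : 0 <= c by apply: le_trans c1.
apply: Qp_abs_sum_le => [|s _]; first by rewrite mulr_ge0 // exprn_ge0.
rewrite -mulrBr Qp_absM Qp_abs_sign mul1r.
have := @Qp_abs_prodB_le _ (index_enum 'I_n) (fun i => A i (s i)) (fun i => B i (s i)) c e.
rewrite /index_enum -enumT size_enum_ord; apply => // i.
by have := hAB i (s i); rewrite !mxE.
Qed.

(** The determinant being 1, the inverse is the adjugate, whose entries are minors of size n-1 up to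
    sign. *)
Lemma mx_le_inv n (A : 'M[K]_n) (c : rat) : 0 <= c -> \det A = 1 -> mx_le c A ->
  mx_le (c ^+ n.-1) (invmx A).
Proof.
move=> c0 dA hA i j; rewrite /invmx unitmxE dA unitr1 invr1 scale1r mxE.
rewrite /cofactor Qp_absM Qp_abs_sign mul1r.
by apply: Qp_abs_det_le => // k l; rewrite !mxE.
Qed.

Lemma mx_le_ex m n (A : 'M[K]_(m, n)) : exists2 c : rat, 1 <= c & mx_le c A.
Proof.
exists (\big[Num.max/1]_(ij : 'I_m * 'I_n) Qp_abs (A ij.1 ij.2)).
  exact: bigmax_ge_id.
by move=> i j; have := @le_bigmax _ _ _ 1 (fun ij => Qp_abs (A ij.1 ij.2)) (i, j).
Qed.

Lemma mx_le_eq0 m n (A : 'M[K]_(m, n)) :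
  (forall e : rat, 0 < e -> mx_le e A) -> A = 0.
Proof.
move=> h; apply/matrixP => i j; apply/eqP; rewrite mxE -Qp_abs_eq0 eq_le Qp_abs_ge0 andbT.
by rewrite leNgt; apply/negP => a0; have := h _ (divr_gt0 a0 (ltr0n _ 2)) i j; lra.
Qed.

Lemma ultra_lim_mx (T : Type) (F : set_system T) (FF : UltraFilter F)
    m n (f : T -> 'M[K]_(m, n)) (c : rat) : (\forall t \near F, mx_le c (f t)) ->
  exists A, forall e : rat, 0 < e -> \forall t \near F, mx_le e (f t - A).
Proof.
move=> fc.
have /choice[A hA] (ij : 'I_m * 'I_n) : exists x : K, forall e : rat, 0 < e ->
    \forall t \near F, Qp_abs (f t ij.1 ij.2 - x) < e.
  by apply: (@ultra_lim_Qp _ hp _ _ FF _ c); apply: filterS fc => t; exact.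
exists (\matrix_(i, j) A (i, j)) => e e0.
have : \forall t \near F, forall ij : 'I_m * 'I_n,
    Qp_abs (f t ij.1 ij.2 - A ij) < e.
  by apply: filter_forall => ij; apply: hA.
by apply: filterS => t h i j; rewrite !mxE; exact/ltW/(h (i, j)).
Qed.

(** A limit along an ultrafilter containing every tail of the sequence is a cluster point. *)
Lemma bounded_seq_cluster m n (f : nat -> 'M[K]_(m, n)) (c : rat) :
  (forall k, mx_le c (f k)) ->
  exists A, forall (e : rat) N, 0 < e -> exists2 k, (N <= k)%N & mx_le e (f k - A).
Proof.
move=> fc; have [F [FF Foo]] := ultraFilterLemma (F := \oo) _.
have [|A hA] := ultra_lim_mx FF (f := f) (c := c); first exact: filterE.
exists A => e N e0; have FN : F [set k | (N <= k)%N] by apply: Foo; exists N.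
by have [k [Nk hk]] := filter_ex (filterI FN (hA e e0)); exists k.
Qed.

Lemma nbhs_mx_le m n (A : 'M[K]_(m, n)) (U : set 'M[K]_(m, n)) :
  nbhs A U <-> exists2 e : rat, 0 < e & forall B, mx_le e (B - A) -> U B.
Proof.
split.
  case=> P hP sub.
  have /choice[e he] (ij : 'I_m * 'I_n) : exists e : rat, 0 < e /\
      forall x : K, Qp_abs (x - A ij.1 ij.2) < e -> P ij.1 ij.2 x.
    have /nbhs_ballP[e /= e0 sb] := hP ij.1 ij.2; exists e; split => // x hx.
    by apply: sb; rewrite ballEmdist /=; change (Qp_abs (A ij.1 ij.2 - x) < e);
      rewrite -opprB Qp_absN.
  (* Finitely many positive radii have a positive minimum; halving it gives the strict inequality
     that open metric balls require. *)
  have [d d0 hd] : exists2 d : rat, 0 < d & forall ij, d < e ij.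
    exists (\big[Num.min/1]_(ij : 'I_m * 'I_n) e ij / 2).
      by rewrite divr_gt0 // lt_bigmin // => ij _; case: (he ij).
    move=> ij; have := bigmin_le 1 ij e; have [e0 _] := he ij; lra.
  exists d => // B hB; apply: sub => i j.
  case: (he (i, j)) => _; apply; apply: le_lt_trans (hd _).
  by have := hB i j; rewrite !mxE.
case=> e e0 he; exists (fun i j => ball (A i j) e) => [i j|B hB].
  exact: nbhsx_ballx.
apply: he => i j; rewrite !mxE -opprB Qp_absN.
by apply/ltW; have := hB i j; rewrite ballEmdist.
Qed.

End MatrixBounds.

(** * Neighbourhoods in subspaces of matrices *)

Section SphereDistal.
Variables (p : nat) (hp : prime p).
Local Notation K := (Qp hp).

(** One description of neighbourhoods serves both the sphere and SL(n). *)
Lemma nbhs_set_mx_le m n (P : set 'M[K]_(m, n)) (x : set_type P) (U : set (set_type P)) :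
  nbhs x U <->
  exists2 e : rat, 0 < e & forall y : set_type P, mx_le e (val y - val x) -> U y.
Proof.
split.
  case=> _ [[W oW <-] Wx sub].
  have /nbhs_mx_le[e e0 he] : nbhs (val x) W by apply: open_nbhs_nbhs.
  by exists e => // y hy; apply/sub/he.
case=> e e0 he.
have nB : nbhs (val x) [set B | mx_le e (B - val x)].
  by apply/nbhs_mx_le; exists e.
have := @initial_continuous _ _ (val : set_type P -> _) x _ nB.
by apply: (@filterS _ (nbhs x)) => y; apply: he.
Qed.

(** * The norm of vectors and normalization *)

Section Vectors.
Variable n : nat.
Implicit Types v w : 'cV[K]_n.

Lemma vnorm_leP v (e : rat) : 0 <= e -> vnorm v <= e <-> mx_le e v.
Proof.
move=> e0; split=> [h i j|h]; first by rewrite ord1 (le_trans (vnorm_ge v i)).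
by have [->|[i ->]] := vnormP v.
Qed.

(** Ultrametric triangles are isosceles: the norm is locally constant away from 0. *)
Lemma vnorm_eq v w : vnorm (v - w) < vnorm w -> vnorm v = vnorm w.
Proof.
have tri (x y : 'cV[K]_n) (e : rat) :
    0 <= e -> vnorm x <= e -> vnorm y <= e -> vnorm (x + y) <= e.
  by move=> e0 /(vnorm_leP _ e0) hx /(vnorm_leP _ e0) hy; apply/vnorm_leP/mx_leD.
have symm (x y : 'cV[K]_n) : vnorm (x - y) = vnorm (y - x).
  by rewrite -opprB -scaleN1r vnormZ Qp_absN Qp_abs1 mul1r.
move=> h; apply/eqP; rewrite eq_le; apply/andP; split.
  by rewrite -[v in vnorm v](subrK w) tri ?vnorm_ge0 // ltW.
rewrite leNgt; apply/negP => vw.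
have := tri (w - v) v (Num.max (vnorm (w - v)) (vnorm v)).
rewrite subrK le_max vnorm_ge0 !le_max !lexx orbT symm => /(_ isT isT isT) /orP[] hw.
  by move: h; rewrite ltNge hw.
by move: vw; rewrite ltNge hw.
Qed.

(** The norm of the scaled vector gains the factor p^-k, which cancels the scalar p^k. *)
Lemma normalizeZ v (k : int) : normalize (Qp_of_rat hp (p%:R ^ k) *: v) = normalize v.
Proof.
rewrite /normalize vnormZ Qp_abs_of_rat padic_abs_pX // scalerA.
rewrite -!(fmorph_eq_rat (Qp_of_rat hp)) -rmorphM /= mulrAC -expfzDr.
  by rewrite addNr expr0z mul1r.
by rewrite gt_eqF // p_gt0.
Qed.

(** Near [w] the norm is constant, so normalization is multiplication by a fixed scalar there. *)
Lemma normalize_near w (e : rat) : w != 0 -> 0 < e ->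
  exists2 d : rat, 0 < d &
    forall v, mx_le d (v - w) -> mx_le e (normalize v - normalize w).
Proof.
move=> w0 e0; have r0 : 0 < vnorm w by rewrite lt0r vnorm_eq0 w0 vnorm_ge0.
have s0 : 0 < padic_abs p (vnorm w) by rewrite padic_abs_gt0 // gt_eqF.
(* The first bound, halved for strictness, freezes the norm; the second absorbs the fixed scalar. *)
exists (Num.min (vnorm w / 2) (e / padic_abs p (vnorm w))).
  by rewrite lt_min !divr_gt0.
move=> v hv; have vw : vnorm v = vnorm w.
  apply: vnorm_eq; apply: (@le_lt_trans _ _ (vnorm w / 2)); last by lra.
  apply/vnorm_leP; first by rewrite ltW // divr_gt0.
  by apply: mx_leW hv; rewrite ge_min lexx.
move=> i j; rewrite /normalize vw -scalerBr mxE Qp_absM Qp_abs_ratr mulrC.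
rewrite -ler_pdivlMr //; apply: le_trans (hv i j) _.
by rewrite ge_min lexx orbT.
Qed.

End Vectors.

(** * Closures of bounded semigroups of SL(n) *)

Section Closure.
Variable n : nat.
Implicit Types (S : set (SL K n)) (T U : SL K n).

Lemma closure_SL_mx_le S T :
  closure S T <->
  forall e : rat, 0 < e -> exists2 U, S U & mx_le e (mx_of_SL U - mx_of_SL T).
Proof.
split=> [cT e e0|h B].
  have [|U [SU hU]] := cT [set U | mx_le e (mx_of_SL U - mx_of_SL T)].
    by apply/(@nbhs_set_mx_le _ _ (@SL_set K n)); exists e.
  by exists U.
move=> /(@nbhs_set_mx_le _ _ (@SL_set K n))[e e0 he].
by have [U SU hU] := h e e0; exists U; split => //; apply: he.
Qed.

(** The determinant is continuous on bounded sets. With [d] equal to 1 this keeps limits in SL(n);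
    with 0 it makes a limit of rescaled matrices singular. *)
Lemma det_limit (A : 'M[K]_n) (c : rat) (d : K) : 1 <= c ->
  (forall e : rat, 0 < e -> exists B : 'M[K]_n,
     [/\ mx_le c B, mx_le e (B - A) & Qp_abs (\det B - d) <= e]) -> \det A = d.
Proof.
move=> c1 h; have c0 : 0 < c by apply: lt_le_trans c1.
have hA : mx_le c A.
  have [B [hB hBA _]] := h c c0.
  by rewrite -[A](subKr B); apply: mx_leD => //; apply: mx_leN.
apply/eqP; rewrite -subr_eq0 -Qp_abs_eq0 eq_le Qp_abs_ge0 andbT leNgt.
apply/negP => a0; set a := Qp_abs _ in a0.
have cn1 : 1 <= c ^+ n by rewrite exprn_ege1.
have cn : 0 < c ^+ n by rewrite exprn_gt0.
(* With this tolerance both differences are at most a/2, while their sum has absolute value [a]. *)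
have e0 : 0 < a / (c ^+ n * 2) by rewrite divr_gt0 // mulr_gt0.
have [B [hB hBA hd]] := h _ e0.
have ea : c ^+ n * (a / (c ^+ n * 2)) = a / 2 by field; rewrite gt_eqF.
have : a <= a / 2; last by lra.
rewrite {1}/a -[\det A](subrK (\det B)) -addrA.
apply: le_trans (Qp_abs_ultra _ _) _; rewrite ge_max; apply/andP; split.
  by rewrite -ea; apply: Qp_abs_detB_le => //; [exact: ltW|exact: mx_leB_sym].
apply: le_trans hd _; rewrite -ea ler_peMl // ltW //.
Qed.

Lemma closure_bounded S (c : rat) : 1 <= c -> (forall T, S T -> mx_le c T) ->
  forall T, closure S T -> mx_le c T.
Proof.
move=> c1 hS T /closure_SL_mx_le/(_ c (lt_le_trans ltr01 c1))[U /hS hU hUT].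
by rewrite -[mx_of_SL T](subKr (mx_of_SL U)); apply: mx_leD => //; apply: mx_leN.
Qed.

(** An ultrafilter on the bounded closure has an entrywise limit, of determinant 1 by continuity,
    hence in SL(n) and in the closed set. *)
Lemma bounded_compact_closure S (c : rat) : 1 <= c -> (forall T, S T -> mx_le c T) ->
  compact (closure S).
Proof.
move=> c1 hS; rewrite compact_ultra => F FF FS.
have Fc : \forall T \near F, mx_le c (mx_of_SL T).
  by apply: filterS FS => T; apply: closure_bounded.
have [A hA] := ultra_lim_mx FF (f := @mx_of_SL K n) Fc.
have dA : \det A = 1.
  apply: (det_limit c1) => e e0.
  have [T [hT hTA]] := filter_ex (filterI Fc (hA e e0)).
  by exists T; split => //; rewrite SL_det subrr Qp_abs0 ltW.
have FA : F --> mkSL dA.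
  move=> B /(@nbhs_set_mx_le _ _ (@SL_set K n))[e e0 he].
  by apply: filterS (hA e e0) => T; apply: he.
exists (mkSL dA); split => //.
by apply: closed_closure => B /FA FB; apply: filter_ex (filterI FS FB).
Qed.

Lemma closure_semigroup S : is_semigroup S ->
  forall T U, closure S T -> closure S U -> closure S (T * U)%g.
Proof.
move=> [_ SM] T U /closure_SL_mx_le cT /closure_SL_mx_le cU.
apply/closure_SL_mx_le => e e0.
have [c c1 hT] := mx_le_ex T; have [d d1 hU] := mx_le_ex U.
have c0 : 0 < c by apply: lt_le_trans c1.
have d0 : 0 < d by apply: lt_le_trans d1.
have [|T' ST' hT'] := cT (e / d); first exact: divr_gt0.
(* [Num.max c (e / d)] bounds the entries of [T'], which multiplies the error made on [U]. *)
have [|U' SU' hU'] := cU (Num.min d (e / Num.max c (e / d))).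
  by rewrite lt_min d0 divr_gt0 // lt_max c0.
have hT'c : mx_le (Num.max c (e / d)) T'.
  rewrite -[mx_of_SL T'](subrK (mx_of_SL T)).
  by apply: mx_leD; [apply: mx_leW hT'|apply: mx_leW hT]; rewrite le_max lexx ?orbT.
exists (T' * U')%g; first exact: SM.
have -> : mx_of_SL (T' * U')%g - mx_of_SL (T * U)%g
    = T' *m (mx_of_SL U' - mx_of_SL U) + (mx_of_SL T' - mx_of_SL T) *m U.
  by rewrite mulmxBr mulmxBl subrKA.
have M0 : 0 < Num.max c (e / d) by rewrite lt_max c0.
apply: mx_leD.
  rewrite -[e](divfK (lt0r_neq0 M0)) mulrC.
  apply: mx_leM => //; [exact: ltW|by rewrite ltW ?divr_gt0|].
  by apply: mx_leW hU'; rewrite ge_min lexx orbT.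
rewrite -[e](divfK (lt0r_neq0 d0)).
by apply: mx_leM => //; rewrite ltW ?divr_gt0.
Qed.

Lemma bounded_closure_subgroup S (c : rat) : 1 <= c -> (forall T, S T -> mx_le c T) ->
  is_semigroup S -> is_subgroup (closure S).
Proof.
move=> c1 hS sS; have c0 : 0 < c by apply: lt_le_trans c1.
have GM := closure_semigroup sS; have Gc := closure_bounded c1 hS.
have GV T : closure S T -> closure S (T^-1)%g.
  move=> GT; have GX k : closure S (T ^+ k.+1)%g.
    by elim: k => [|k IH]; [rewrite expg1|rewrite expgS; apply: GM].
  have [A hA] := @bounded_seq_cluster _ hp _ _
    (fun k => mx_of_SL (T ^+ k.+1)%g) c (fun k => Gc _ (GX k)).
  apply: closed_closure; apply/closure_SL_mx_le => e e0.
  have cn : 0 < c ^+ n.-1 by rewrite exprn_gt0.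
  (* The divisor bounds the inverse of the power of [T] that will multiply a small difference. *)
  have ec0 : 0 < e / c ^+ n.-1 by rewrite divr_gt0.
  have [i _ hi] := hA _ 0%N ec0.
  (* Multiplying by T^-(i+2) turns T^(i+1) into the inverse of [T] and, as j is at least i+2, turns
     T^(j+1) into a positive power, which lies in the closure. *)
  have [j ij hj] := hA _ i.+2 ec0.
  have [m Em] : exists m, j = (m + i.+2)%N by exists (j - i.+2)%N; rewrite subnK.
  exists (T ^+ m.+1)%g => //.
  have -> : mx_of_SL (T ^+ m.+1)%g - mx_of_SL (T^-1)%g
      = invmx (mx_of_SL (T ^+ i.+2)%g) *m (mx_of_SL (T ^+ j.+1)%g - mx_of_SL (T ^+ i.+1)%g).
    rewrite mulmxBr.
    have -> : (T ^+ m.+1)%g = ((T ^+ i.+2)^-1 * T ^+ j.+1)%g.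
      by rewrite Em -addSn addnC expgnDr mulKg.
    have -> : (T^-1)%g = ((T ^+ i.+2)^-1 * T ^+ i.+1)%g.
      by rewrite expgSr invgM mulgVK.
    by [].
  rewrite -[e](divfK (lt0r_neq0 cn)) mulrC.
  apply: mx_leM; [exact: ltW|exact: ltW| |].
    by apply: mx_le_inv; [exact: ltW|exact: SL_det|exact: Gc].
  exact: mx_leB_trans hj (mx_leB_sym hi).
split => //; have [[T ST] _] := sS.
by rewrite -(mulgV T); apply: GM; [|apply: GV]; apply: subset_closure.
Qed.

End Closure.
End SphereDistal.

(** * Distality on the sphere against compactness and boundedness *)

Section Distal.
Variables (p : nat) (hp : prime p) (n : nat).
Local Notation K := (Qp hp).
Implicit Types (S : set (SL K n)) (T U : SL K n) (x y d : sphere hp n).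

Lemma sphere_action_inj T : injective (sphere_action (p := p) (hp := hp) T).
Proof.
move=> x y /(congr1 (sphere_action T^-1%g)).
by rewrite -!sphere_actionM mulVg !sphere_action1.
Qed.

(** Evaluation at [x] is continuous in the matrix, and normalization is continuous at the nonzero
    vector [T *m x]. *)
Lemma sphere_action_near T x (e : rat) : 0 < e ->
  exists2 c : rat, 0 < c & forall U, mx_le c (mx_of_SL U - mx_of_SL T) ->
    mx_le e (cV_of_sphere (sphere_action U x) - cV_of_sphere (sphere_action T x)).
Proof.
move=> e0; have Tx0 : T *m x != 0.
  apply/eqP => Tx0; have := sphere_action_subproof T x.
  by rewrite Tx0 vnormZ (eqP (_ : vnorm 0 == 0)) ?vnorm_eq0 // mulr0 => /eqP;
    rewrite eq_sym oner_eq0.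
have [c c0 hc] := normalize_near Tx0 e0; exists c => // U hU.
apply: hc; rewrite -mulmxBl -[c]mulr1; apply: mx_leM => //; first exact: ltW.
by apply/vnorm_leP => //; rewrite vnorm_sphere.
Qed.

Lemma compact_closure_distal S : compact (closure S) -> acts_distally_on_sphere S.
Proof.
move=> cS x y xy; rewrite -subset0 => -[d d'] [/= cl]; rewrite /diagonal /= => dd.
subst d'; apply: xy.
have near_d (k : nat) : exists T, [/\ S T,
    mx_le (p%:R ^- k) (cV_of_sphere (sphere_action T x) - cV_of_sphere d) &
    mx_le (p%:R ^- k) (cV_of_sphere (sphere_action T y) - cV_of_sphere d)].
  pose V : set (sphere hp n) := [set z | mx_le (p%:R ^- k) (cV_of_sphere z - cV_of_sphere d)].
  have nV : nbhs d V.
    by apply/(@nbhs_set_mx_le _ _ _ _ (@sphere_set _ hp n)); exists (p%:R ^- k) => //;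
      apply: pXN_gt0.
  have [|_ [[_ [T ST <-] <-] [/= h1 h2]]] := cl (V `*` V); first by exists (V, V).
  by exists T; split; [exact: ST|move: h1|move: h2]; rewrite /V /mkset.
have [T_ hT] := choice near_d.
(* It remains to show that this cluster point sends both [x] and [y] to [d]; injectivity then
   concludes. *)
have [T [_ clT]] := cS (T_ @ \oo) _ (filterE _
  (fun k => subset_closure (let: And3 h _ _ := hT k in h))).
suff lim z : (forall k,
      mx_le (p%:R ^- k) (cV_of_sphere (sphere_action (T_ k) z) - cV_of_sphere d)) ->
    sphere_action T z = d.
  apply: (@sphere_action_inj T).
  by rewrite !lim // => k; case: (hT k).
move=> hz; apply: val_inj; apply/eqP; rewrite -subr_eq0; apply/eqP.
apply: mx_le_eq0 => e e0.
have [c c0 hc] := sphere_action_near T z e0.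
have [N hN] := pXN_lt hp e0.
(* The index [k] is so large that the image of [z] is near [d], and [T_ k] is near [T]. *)
have [||U [/= [k Nk <-] hU]] := clT (T_ @` [set k | (N <= k)%N])
  [set U | mx_le c (mx_of_SL U - mx_of_SL T)].
- by exists N => // k Nk; exists k.
- by apply/(@nbhs_set_mx_le _ _ _ _ (@SL_set K n)); exists c.
apply: mx_leB_trans (mx_leB_sym (hc _ hU)) _.
by apply: mx_leW (hz k); rewrite (le_trans (pXN_le hp Nk)) // ltW.
Qed.

(** The largest absolute value of an entry is a power of p, so scaling by a power of p makes it
    exactly 1; p^z is its inverse, whence the bound by 1/c. *)
Lemma mx_rescale m k (A : 'M[K]_(m, k)) (c : rat) : 0 < c -> ~ mx_le c A ->
  exists z : int, [/\ p%:R ^ z < c^-1, mx_le 1 (Qp_of_rat hp (p%:R ^ (- z)) *: A) &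
    exists i j, Qp_abs ((Qp_of_rat hp (p%:R ^ (- z)) *: A) i j) = 1].
Proof.
move=> c0 nA.
have [i [j Aij]] : exists i j, c < Qp_abs (A i j).
  apply: contrapT => H; apply: nA => i j; rewrite leNgt; apply/negP => h.
  by apply: H; exists i, j.
have [[i0 j0] _ /= hmax] := @arg_maxP _ _ _ (i, j) xpredT
  (fun ij => Qp_abs (A ij.1 ij.2)) isT.
have A0 : c < Qp_abs (A i0 j0) by apply: lt_le_trans Aij (hmax (i, j) isT).
have [|z Ez] := @Qp_abs_pX _ hp (A i0 j0).
  by rewrite -Qp_abs_eq0 gt_eqF // (lt_trans c0).
have q0 : 0 < p%:R ^ z :> rat by rewrite exprz_gt0 // p_gt0.
exists (- z); rewrite opprK; split; first by rewrite -invr_expz ltf_pV2 ?posrE // -Ez.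
  move=> i1 j1; rewrite mxE Qp_absM Qp_abs_of_rat padic_abs_pX // -invr_expz.
  by rewrite mulrC ler_pdivrMr // mul1r -Ez (hmax (i1, j1)).
exists i0, j0; rewrite mxE Qp_absM Qp_abs_of_rat padic_abs_pX // -invr_expz Ez.
by rewrite mulVf // gt_eqF.
Qed.

Lemma distal_bounded S : (0 < n)%N -> acts_distally_on_sphere S ->
  exists2 c : rat, 1 <= c & forall T, S T -> mx_le c T.
Proof.
move=> n0 dS; apply: contrapT => H.
(* Each pair holds a matrix of [S] and its rescaling, which induces the same map on the sphere but
   has a small determinant. *)
have big (k : nat) : exists TB : SL K n * 'M[K]_n, [/\ S TB.1,
    forall x : 'cV[K]_n, normalize (TB.1 *m x) = normalize (TB.2 *m x),
    mx_le 1 TB.2, exists i j, Qp_abs (TB.2 i j) = 1 & Qp_abs (\det TB.2) <= p%:R ^- k].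
  have pk1 : 1 <= p%:R ^+ k :> rat by rewrite exprn_ege1 // ler1n prime_gt0.
  have [T [ST nT]] : exists T, S T /\ ~ mx_le (p%:R ^+ k) T.
    apply: contrapT => H'; apply: H; exists (p%:R ^+ k) => // T ST.
    by apply: contrapT => nT; apply: H'; exists T.
  have [z [hz B1 Bij]] := mx_rescale (lt_le_trans ltr01 pk1) nT.
  exists (T, Qp_of_rat hp (p%:R ^ (- z)) *: mx_of_SL T); split => //= [x|].
    by rewrite -scalemxAl normalizeZ.
  rewrite detZ SL_det mulr1 Qp_absX Qp_abs_of_rat padic_abs_pX // opprK.
  have q0 : 0 <= p%:R ^ z :> rat by rewrite ltW // exprz_gt0 // p_gt0.
  (* The determinant has absolute value (p^z)^n: as [n] is positive, one factor is at most p^-k and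
     the others are at most 1. *)
  rewrite -(prednK n0) exprS -[_ ^- k]mulr1; apply: ler_pM; rewrite ?exprn_ge0 //.
    exact: ltW.
  by rewrite exprn_ile1 // ltW // (lt_le_trans hz) // invf_le1 // (lt_le_trans ltr01).
have [TB hTB] := choice big.
have [A hA] := @bounded_seq_cluster _ hp _ _ (fun k => (TB k).2) 1
  (fun k => let: And5 _ _ h _ _ := hTB k in h).
have dA : \det A = 0.
  apply: (det_limit (lexx 1)) => e e0; have [N hN] := pXN_lt hp e0.
  have [k Nk hk] := hA e N e0; have [_ _ B1 _ dB] := hTB k.
  exists (TB k).2; split => //; rewrite subr0 (le_trans dB) //.
  by rewrite (le_trans (pXN_le hp Nk)) // ltW.
have A0 : A != 0.
  (* An entry of absolute value 1 cannot be within 1/2 of 0. *)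
  apply/eqP => A0; have [k _ hk] := hA 2^-1 0%N isT.
  have [_ _ _ [i [j Bij]] _] := hTB k.
  by have := hk i j; rewrite A0 subr0 Bij.
have [x x0 Ax0] : exists2 x : 'cV[K]_n, x != 0 & A *m x = 0.
  have /det0P[v v0 vA] : \det A^T == 0 by rewrite det_tr dA.
  exists v^T; first by rewrite trmx_eq0.
  by apply: trmx_inj; rewrite trmx_mul trmxK vA trmx0.
have [j Aj] : exists j, A *m (delta_mx j 0 : 'cV[K]_n) != 0.
  apply: contrapT => H'; move/eqP: A0; apply; apply/matrixP => i j.
  have [//|nz] := eqVneq (A *m (delta_mx j 0 : 'cV[K]_n)) 0; last by case: H'; exists j.
  by move/matrixP/(_ i 0); rewrite -colE !mxE.
set y : 'cV[K]_n := delta_mx j 0 in Aj.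
have y1 : vnorm y = 1.
  apply/eqP; rewrite eq_le; apply/andP; split.
    apply/vnorm_leP => // i l; rewrite mxE.
    by case: (_ && _); rewrite ?Qp_abs1 ?Qp_abs0.
  by apply: le_trans (vnorm_ge y j); rewrite mxE !eqxx Qp_abs1.
(* A kernel vector of norm 1/p: adding it to [y] changes neither the norm nor the image under
   [A]. *)
pose x' := Qp_of_rat hp (p%:R ^ 1) *: normalize x.
have nx' : vnorm x' = p%:R^-1.
  by rewrite vnormZ vnorm_normalize // mulr1 Qp_abs_of_rat padic_abs_pX.
have y2 : vnorm (y + x') = 1.
  rewrite -y1; apply: vnorm_eq; rewrite addrAC subrr add0r nx' y1.
  by rewrite invf_lt1 ?p_gt0 // ltr1n prime_gt1.
have Ay2 : A *m (y + x') = A *m y.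
  by rewrite mulmxDr -!scalemxAr Ax0 !scaler0 addr0.
pose s1 : sphere hp n := SigSub (mem_set y1).
pose s2 : sphere hp n := SigSub (mem_set y2).
pose d : sphere hp n := SigSub (mem_set (vnorm_normalize Aj)).
have s12 : s1 <> s2.
  move=> /(congr1 (@cV_of_sphere _ hp n)) E; change (y = y + x') in E.
  have : x' = 0 by apply: (addrI y); rewrite addr0 -E.
  move/eqP; rewrite -vnorm_eq0 nx' invr_eq0.
  by rewrite gt_eqF // p_gt0.
have := dS s1 s2 s12; rewrite -subset0 => /(_ (d, d)); apply; split => //.
move=> W [[V1 V2] [/= nV1 nV2] sub].
(* Both images approach the same [d], so one neighbourhood handles the two coordinates. *)
have /(@nbhs_set_mx_le _ _ _ _ (@sphere_set _ hp n))[e e0 he] : nbhs d (V1 `&` V2).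
  exact: filterI.
have [c c0 hc] := normalize_near Aj e0.
have [k _ hk] := hA c 0%N c0; have [ST hn _ _ _] := hTB k.
exists (sphere_action (TB k).1 s1, sphere_action (TB k).1 s2); split.
  by exists (sphere_action (TB k).1) => //; exists (TB k).1.
have near_d (s : sphere hp n) : A *m s = A *m y ->
    (V1 `&` V2) (sphere_action (TB k).1 s).
  (* [hn] replaces the matrix of [S] by its rescaling, which is close to [A]. *)
  move=> As; apply: he => /=; rewrite hn; apply: hc; rewrite -As -mulmxBl -[c]mulr1.
  apply: mx_leM => //; first exact: ltW.
  by apply/vnorm_leP => //; rewrite vnorm_sphere.
apply: sub; split => /=; first by have [] := near_d s1 erefl.
by have [] := near_d s2 Ay2.
Qed.

End Distal.

Theorem corollary2p5 (p : nat) (hp : prime p) (n : nat) (hn : (0 < n)%N)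
    (S : set (SL (Qp hp) n)) (hS : is_semigroup S) :
  acts_distally_on_sphere S <->
  compact (closure S) /\ is_subgroup (closure S).
Proof.
split=> [dS|[cS _]]; last exact: compact_closure_distal.
have [c c1 hc] := distal_bounded hn dS.
by split; [exact: bounded_compact_closure hc|exact: bounded_closure_subgroup hc hS].
Qed.
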